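(* Let $W\subset S^1$ with $|W|=4$ satisfy condition $T'(W)$: $(W+\tfrac ik)\cap W=\emptyset$ for $k\in\{4,5\}$ and all $i$ with $1\le i\le k-1$, $\gcd(i,k)=1$. Then $P(W)$ holds.
   Context: Identify $S^1$ with $\mathbb{R}/\mathbb{Z}$. The group $O(2)$ acts on $S^1$ by translations $\sigma_a(x)=x+a$ and reflections $\tau_a(x)=-x+2a$. A coloring $c:S^1\to\{R,B\}$ is distinguishing if no non-identity $\gamma\in O(2)$ satisfies $c\circ\gamma=c$. For $W\subset S^1$ with trivial pointwise stabilizer in $O(2)$, $P(W)$ holds if every precoloring $c:S^1\setminus W\to\{R,B\}$ extends to a distinguishing coloring of $S^1$. *)

(* Defs.v *)
(* S^1 = R/Z is modelled by R, with points identified mod 1. *)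
From Stdlib Require Import Reals List Arith.
Open Scope R_scope.

Definition eqS1 (x y : R) : Prop := exists k : Z, x - y = IZR k.

(* A map R -> bool descends to S^1 = R/Z iff it is 1-periodic. *)
Definition coloring_S1 (c : R -> bool) : Prop := forall x : R, c (x + 1) = c x.

(* O(2) acting on R/Z: translations and reflections *)
Definition sigma (a x : R) : R := x + a.
Definition tau (a x : R) : R := - x + 2 * a.

(* c is distinguishing: no non-identity element of O(2) preserves c.
   sigma_a is the identity of S^1 iff a is an integer (i.e. a = 0 in R/Z);
   tau_a is never the identity of S^1. *)
Definition distinguishing (c : R -> bool) : Prop :=
  (forall a : R, (forall x : R, c (sigma a x) = c x) -> eqS1 a 0) /\
  (forall a : R, ~ (forall x : R, c (tau a x) = c x)).

(* A finite subset W of S^1, given by a list of representatives. *)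
Definition inW (W : list R) (x : R) : Prop := exists w, In w W /\ eqS1 x w.

Definition card4_S1 (W : list R) : Prop :=
  length W = 4%nat /\ NoDup W /\ Forall (fun w => 0 <= w < 1) W.

Definition trivial_pointwise_stab (W : list R) : Prop :=
  (forall a : R, (forall w, In w W -> eqS1 (sigma a w) w) -> eqS1 a 0) /\
  (forall a : R, ~ (forall w, In w W -> eqS1 (tau a w) w)).

(* P(W): every precoloring of S^1 \ W extends to a distinguishing coloring.
   A precoloring of S^1 \ W is represented by any coloring c0 of S^1
   (its values on W are irrelevant). *)
Definition P (W : list R) : Prop :=
  forall c0 : R -> bool, coloring_S1 c0 ->
    exists c : R -> bool, coloring_S1 c /\ distinguishing c /\
      (forall x : R, ~ inW W x -> c x = c0 x).

Definition T' (W : list R) : Prop :=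
  forall k i : nat, (k = 4%nat \/ k = 5%nat) -> (1 <= i <= k - 1)%nat ->
    Nat.gcd i k = 1%nat ->
    forall w w' : R, In w W -> In w' W -> ~ eqS1 (w + INR i / INR k) w'.

(* Main.v *)
(** If no extension is distinguishing, each of the 16 colorings [c_A] obtained by
    flipping [A] inside [W] has a translation or a reflection symmetry.

    If [c] has a translation symmetry, then every [c + w] can only be reflected
    at [w], so [c] is invariant under the reflections [x -> 2w - x] for all [w]
    in [W].  Hence two colorings [c], [c + D] with translation symmetries force
    [D = 2w - D] for all [w] in [W], which makes [D] an equilateral triple; as
    there is at most one such triple, some three-dimensional face of the cube of
    colorings contains no coloring with a translation symmetry.

    On such a face every [c_A] has exactly one reflection [x -> s_A - x].  The
    product of two reflections changes [c] only at a few points of [W] and their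
    mirror images, and all these translations commute; so sums of indicator
    functions of points that are integer combinations of the [s_A] and of [W]
    vanish mod 2, and their terms must coincide in pairs.  Every way of pairing
    them contradicts the hypotheses on [W]; the cases are enumerated by a
    verified search that keeps track of the lattice of integer relations found
    so far. *)

Require Import Defs.
From Stdlib Require Import Reals List Arith.
From Stdlib Require Import ZArith Bool Lia Lra Classical ClassicalEpsilon.
Import ListNotations.
Open Scope R_scope.

(** * The circle *)

Lemma eqS1_refl (x : R) : eqS1 x x.
Proof. exists 0%Z; simpl; ring. Qed.

Lemma eqS1_sym (x y : R) : eqS1 x y -> eqS1 y x.
Proof. intros [k Hk]; exists (- k)%Z; rewrite opp_IZR; lra. Qed.

Lemma eqS1_trans (x y z : R) : eqS1 x y -> eqS1 y z -> eqS1 x z.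
Proof. intros [k Hk] [l Hl]; exists (k + l)%Z; rewrite plus_IZR; lra. Qed.

Lemma eqS1_eq (x y z t : R) : x - y = z - t -> eqS1 x y -> eqS1 z t.
Proof. intros E [k Hk]; exists k; lra. Qed.

Lemma eqS1_sub_mul (x y : R) (q : Z) :
  eqS1 x 0 -> eqS1 y 0 -> eqS1 (x - IZR q * y) 0.
Proof.
  intros [k Hk] [l Hl]; exists (k - q * l)%Z.
  rewrite minus_IZR, mult_IZR.
  replace x with (IZR k) by lra; replace y with (IZR l) by lra; ring.
Qed.

Definition periodic (g : R -> bool) : Prop :=
  forall x y : R, eqS1 x y -> g x = g y.

Lemma coloring_periodic (c : R -> bool) : coloring_S1 c -> periodic c.
Proof.
  intros Hc.
  assert (N : forall (n : nat) (x : R), c (x + INR n) = c x).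
  { induction n as [|n IH]; intros x.
    - simpl; f_equal; ring.
    - rewrite S_INR; replace (x + (INR n + 1)) with (x + INR n + 1) by ring.
      now rewrite Hc. }
  intros x y [k Hk].
  destruct (Z_le_dec 0 k) as [h|h].
  - rewrite <- (N (Z.to_nat k) y), INR_IZR_INZ, Z2Nat.id by lia; f_equal; lra.
  - rewrite <- (N (Z.to_nat (- k)) x), INR_IZR_INZ, Z2Nat.id by lia.
    rewrite opp_IZR; f_equal; lra.
Qed.

Definition at_pt (w x : R) : bool :=
  if excluded_middle_informative (eqS1 x w) then true else false.

Lemma at_ptP (w x : R) : at_pt w x = true <-> eqS1 x w.
Proof.
  unfold at_pt; destruct (excluded_middle_informative (eqS1 x w)); split;
    easy.
Qed.

Lemma at_pt_iff (w x w' x' : R) :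
  (eqS1 x w <-> eqS1 x' w') -> at_pt w x = at_pt w' x'.
Proof.
  intros H; apply eq_true_iff_eq; rewrite !at_ptP; exact H.
Qed.

Lemma at_pt_shift (w x w' x' : R) : x - w = x' - w' -> at_pt w x = at_pt w' x'.
Proof.
  intros E; apply at_pt_iff; split; apply eqS1_eq; lra.
Qed.

Lemma at_pt_l (w w' x : R) : eqS1 w w' -> at_pt w x = at_pt w' x.
Proof.
  intros H; apply at_pt_iff; split; intros h; eapply eqS1_trans; eauto.
  now apply eqS1_sym.
Qed.

Lemma at_pt_refl (s a b x : R) : eqS1 (a + b) s -> at_pt a (s - x) = at_pt b x.
Proof.
  intros [k Hk]; apply at_pt_iff; split; intros [l Hl].
  - exists (- k - l)%Z; rewrite minus_IZR, opp_IZR; lra.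
  - exists (- k - l)%Z; rewrite minus_IZR, opp_IZR; lra.
Qed.

(** * Colorings and their symmetries *)

(** A list acts as a formal sum over the field with two elements: repeated points cancel, and
    appending is symmetric difference. *)
Definition odd_count (l : list R) (x : R) : bool :=
  fold_right (fun w b => xorb (at_pt w x) b) false l.

Definition flip (c : R -> bool) (l : list R) (x : R) : bool :=
  xorb (c x) (odd_count l x).

(** Here [s] is [2a] for the reflection [tau a]: modulo 1 it determines the reflection and is
    determined by it, whereas [a] is determined only modulo 1/2. *)
Definition reflected (g : R -> bool) (s : R) : Prop :=
  forall x : R, g (s - x) = g x.

Definition translated (g : R -> bool) : Prop :=
  exists t : R, ~ eqS1 t 0 /\ forall x : R, g (x + t) = g x.

Definition symmetric (g : R -> bool) : Prop :=
  translated g \/ exists s : R, reflected g s.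

Lemma odd_count_app (l m : list R) (x : R) :
  odd_count (l ++ m) x = xorb (odd_count l x) (odd_count m x).
Proof.
  induction l as [|w l IH]; simpl; [now destruct (odd_count m x)|].
  now rewrite IH, xorb_assoc.
Qed.

Lemma flip_flip (c : R -> bool) (l m : list R) (x : R) :
  flip (flip c l) m x = flip c (l ++ m) x.
Proof. unfold flip; now rewrite odd_count_app, xorb_assoc. Qed.

Lemma periodic_odd_count (l : list R) : periodic (odd_count l).
Proof.
  intros x y H; induction l as [|w l IH]; simpl; [easy|].
  rewrite IH; f_equal; apply at_pt_iff; split; intros h.
  - apply eqS1_trans with x; [now apply eqS1_sym|easy].
  - now apply eqS1_trans with y.
Qed.

Lemma periodic_flip (c : R -> bool) (l : list R) :
  periodic c -> periodic (flip c l).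
Proof.
  intros Hc x y H; unfold flip.
  now rewrite (Hc x y H), (periodic_odd_count l x y H).
Qed.

Lemma translated_ext (g h : R -> bool) :
  (forall x, g x = h x) -> translated g -> translated h.
Proof. intros E [t [Ht H]]; exists t; split; [easy|intros x; now rewrite <- !E]. Qed.

Lemma reflected_ext (g h : R -> bool) (s : R) :
  (forall x, g x = h x) -> reflected g s -> reflected h s.
Proof. intros E H x; now rewrite <- !E. Qed.

Lemma symmetric_ext (g h : R -> bool) :
  (forall x, g x = h x) -> symmetric g -> symmetric h.
Proof.
  intros E [H|[s H]].
  - left; now apply translated_ext with g.
  - right; exists s; now apply reflected_ext with g.
Qed.

Lemma reflected_eqS1 (g : R -> bool) (s s' : R) :
  periodic g -> eqS1 s s' -> reflected g s -> reflected g s'.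
Proof.
  intros Hg E H x; rewrite <- (H x); apply Hg.
  apply eqS1_eq with s' s; [ring|now apply eqS1_sym].
Qed.

(** Two reflections compose to the translation by [s - s']. *)
Lemma reflected_unique (g : R -> bool) (s s' : R) :
  ~ translated g -> reflected g s -> reflected g s' -> eqS1 s s'.
Proof.
  intros N H H'; apply NNPP; intros E; apply N; exists (s - s'); split.
  - intros h; apply E; revert h; apply eqS1_eq; ring.
  - intros x; replace (x + (s - s')) with (s - (s' - x)) by ring.
    now rewrite H, H'.
Qed.

(** Let [t] be a period of [c]. A period of the flipped coloring, or a reflection other than [2w],
    is refuted by comparing values at [w] and [w + t]: only the first carries the defect. The
    reflection [2w] fixes [w], so it also preserves [c]. *)
Lemma translated_flip1 (c : R -> bool) (w : R) :
  periodic c -> translated c -> symmetric (flip c [w]) -> reflected c (2 * w).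
Proof.
  intros Hc [t [Ht T]] S.
  assert (E : forall x, flip c [w] x = xorb (c x) (at_pt w x)).
  { intros x; unfold flip; simpl; now rewrite xorb_false_r. }
  assert (at_t : at_pt w (w + t) = false).
  { apply not_true_iff_false; rewrite at_ptP; intros h; apply Ht.
    revert h; apply eqS1_eq; ring. }
  assert (at_w : at_pt w w = true) by (apply at_ptP, eqS1_refl).
  destruct S as [[b [Hb B]]|[s S]].
  - exfalso.
    assert (at_b : at_pt w (w + b) = false).
    { apply not_true_iff_false; rewrite at_ptP; intros h; apply Hb.
      revert h; apply eqS1_eq; ring. }
    pose proof (B w) as B1; pose proof (B (w + t)) as B2.
    rewrite !E in B1, B2; rewrite at_b, at_w in B1.
    rewrite at_t, (T w) in B2.
    replace (w + t + b) with (w + b + t) in B2 by ring; rewrite T in B2.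
    destruct (at_pt w (w + b + t)) eqn:h; [|revert B1 B2; destruct (c w), (c (w + b)); easy].
    (* Only [w + b + t = w] survives, and then the period [t] gives [c (w + b) = c w], against
       [B1]. *)
    apply at_ptP in h.
    assert (c (w + b) = c w) as h'.
    { rewrite <- (T (w + b)); apply Hc; exact h. }
    rewrite h' in B1; revert B1; destruct (c w); easy.
  - assert (s2 : eqS1 s (2 * w)).
    { apply NNPP; intros Hs.
      assert (at_s : at_pt w (s - w) = false).
      { apply not_true_iff_false; rewrite at_ptP; intros h; apply Hs.
        revert h; apply eqS1_eq; ring. }
      pose proof (S w) as S1; pose proof (S (w + t)) as S2.
      rewrite !E in S1, S2; rewrite at_s, at_w in S1.
      rewrite at_t, (T w) in S2.
      pose proof (T (s - (w + t))) as T1.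
      replace (s - (w + t) + t) with (s - w) in T1 by ring.
      rewrite T1 in S1.
      destruct (at_pt w (s - (w + t))) eqn:h;
        [|revert S1 S2; destruct (c w), (c (s - (w + t))); easy].
      apply at_ptP in h; apply Hc in h; rewrite h in S1.
      revert S1; destruct (c w); easy. }
    apply reflected_eqS1 with s; [easy..|].
    intros x; specialize (S x); rewrite !E in S.
    rewrite (at_pt_refl s w w x) in S.
    + revert S; destruct (at_pt w x), (c x), (c (s - x)); easy.
    + replace (w + w) with (2 * w) by ring; now apply eqS1_sym.
Qed.

(** * Refuting systems of cancellation rules *)

Fixpoint ev (v : list Z) (rho : list R) : R :=
  match v, rho with
  | x :: v', r :: rho' => IZR x * r + ev v' rho'
  | _, _ => 0
  end.

Open Scope Z_scope.

(* [v - q * r], the shorter vector being padded with zeros *)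
Fixpoint sub_mul (v : list Z) (q : Z) (r : list Z) : list Z :=
  match v, r with
  | x :: v', y :: r' => (x - q * y) :: sub_mul v' q r'
  | [], _ => map (fun y => - q * y) r
  | _, [] => v
  end.

(* A lattice of integer relations in echelon form: entry [i] is, when present,
   the pivot and the remaining coefficients of the row whose first nonzero
   coefficient has index [i]. *)
Definition lattice := list (option (Z * list Z)).

(** Floor division leaves a fixed residue at each nonzero pivot, so full-length vectors congruent
    modulo the rows reduce to the same list and can be compared syntactically. *)
Fixpoint reduce (L : lattice) (v : list Z) : list Z :=
  match L, v with
  | None :: L', x :: v' => x :: reduce L' v'
  | Some (p, r) :: L', x :: v' =>
      let q := x / p in
      if q =? 0 then x :: reduce L' v'
      else (x - q * p) :: reduce L' (sub_mul v' q r)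
  | _, _ => v
  end.

(** Euclid's algorithm by row operations: the first row keeps the gcd up to sign, the second ends
    with leading coefficient 0. Running out of fuel drops the second row, which loses a relation but
    adds no false one. *)
Fixpoint euclid (fuel : nat) (p : Z) (r : list Z) (x : Z) (v : list Z) :=
  match fuel with
  | O => (p, r, [])
  | S fuel' =>
      if x =? 0 then (p, r, v)
      else let q := p / x in euclid fuel' x v (p - q * x) (sub_mul r q v)
  end.

Fixpoint insert (L : lattice) (v : list Z) : lattice :=
  match L, v with
  | None :: L', x :: v' =>
      if x =? 0 then None :: insert L' v' else Some (x, v') :: L'
  | Some (p, r) :: L', x :: v' =>
      let '(g, r', v'') := euclid 50 p r x v' in
      Some (g, r') :: insert L' v''
  | _, _ => L
  end.

Fixpoint eqv (v w : list Z) : bool :=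
  match v, w with
  | x :: v', y :: w' => (x =? y) && eqv v' w'
  | [], [] => true
  | _, _ => false
  end.

Fixpoint toggle (v : list Z) (l : list (list Z)) :=
  match l with
  | [] => [v]
  | w :: l' => if eqv v w then l' else w :: toggle v l'
  end.

Definition cancel (L : lattice) (ts : list (list Z)) :=
  fold_right (fun t => toggle (reduce L t)) [] ts.

Definition in_lattice (L : lattice) (v : list Z) :=
  forallb (Z.eqb 0) (reduce L v).

(* A rule [(ps, ts)] says: if all the relations [ps] hold on the circle, then
   every point occurs an even number of times among the [ts]. *)
Definition rule := (list (list Z) * list (list Z))%type.

(** A short leftover means little branching, so one or two terms are accepted at once. The empty
    list doubles as the mark that no rule has been found yet. *)
Fixpoint select (L : lattice) (best : list (list Z)) (rules : list rule) :=
  match rules with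
  | [] => best
  | (ps, ts) :: rules' =>
      if forallb (in_lattice L) ps then
        let q := cancel L ts in
        match q with
        | [] => select L best rules'
        | [_] | [_; _] => q
        | _ => match best with
               | [] => select L q rules'
               | _ => if Nat.ltb (length q) (length best) then select L q rules'
                      else select L best rules'
               end
        end
      else select L best rules'
  end.

(* The first uncancelled term of an active rule has to coincide with one of the
   others; a single uncancelled term is a contradiction. *)
Fixpoint refute (fuel : nat) (rules : list rule) (L : lattice) : bool :=
  match fuel with
  | O => false
  | S fuel' =>
      match select L [] rules with
      | [] => false
      | t :: ts =>
          forallb (fun t' => refute fuel' rules (insert L (sub_mul t 1 t'))) ts
      end
  end.

(** * Soundness of the refutation search *)

Open Scope R_scope.

Definition holds (rho : list R) (v : list Z) : Prop := eqS1 (ev v rho) 0.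

Definition cancels (rho : list R) (ts : list (list Z)) : Prop :=
  forall x : R, odd_count (map (fun t => ev t rho) ts) x = false.

Definition valid (rho : list R) (r : rule) : Prop :=
  Forall (holds rho) (fst r) -> cancels rho (snd r).

(** Row [i] is stored without its [i] leading zeros, hence the shortened environment. *)
Fixpoint lattice_holds (L : lattice) (rho : list R) : Prop :=
  match L with
  | [] => True
  | o :: L' =>
      match o with Some (p, r) => holds rho (p :: r) | None => True end
      /\ lattice_holds L' (tl rho)
  end.

Lemma ev_nil_r (v : list Z) : ev v [] = 0.
Proof. now destruct v. Qed.

Lemma ev_map_mul (k : Z) (v : list Z) (rho : list R) :
  ev (map (fun y => k * y)%Z v) rho = IZR k * ev v rho.
Proof.
  revert rho; induction v as [|x v IH]; intros [|r rho]; simpl; try ring.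
  rewrite IH, mult_IZR; ring.
Qed.

Lemma ev_sub_mul (v r : list Z) (q : Z) (rho : list R) :
  ev (sub_mul v q r) rho = ev v rho - IZR q * ev r rho.
Proof.
  revert r rho; induction v as [|x v IH]; intros r rho.
  - change (ev (map (fun y => - q * y)%Z r) rho = ev [] rho - IZR q * ev r rho).
    rewrite ev_map_mul, opp_IZR; simpl; ring.
  - destruct r as [|y r]; simpl; [ring|].
    destruct rho as [|a rho]; [ring|].
    rewrite IH, minus_IZR, mult_IZR; ring.
Qed.

Lemma ev_cons (x : Z) (v : list Z) (rho : list R) :
  ev (x :: v) rho = IZR x * hd 0 rho + ev v (tl rho).
Proof. destruct rho; simpl; rewrite ?ev_nil_r; ring. Qed.

Lemma reduce_eqS1 (L : lattice) (v : list Z) (rho : list R) :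
  lattice_holds L rho -> eqS1 (ev (reduce L v) rho) (ev v rho).
Proof.
  revert v rho; induction L as [|o L IH]; intros v rho H; [apply eqS1_refl|].
  destruct H as [Ho H].
  destruct o as [[p r]|], v as [|x v]; cbn [reduce]; cbv zeta; try apply eqS1_refl.
  - destruct (Z.eqb_spec (x / p) 0) as [_|_].
    + rewrite !ev_cons; apply eqS1_eq with (2 := IH v _ H); ring.
    + set (q := (x / p)%Z) in *; unfold holds in Ho.
      rewrite ev_cons in *; specialize (IH (sub_mul v q r) _ H).
      rewrite ev_sub_mul in IH.
      assert (Hx : eqS1 (0 - IZR q * (IZR p * hd 0 rho + ev r (tl rho))) 0)
        by (apply eqS1_sub_mul; [apply eqS1_refl|exact Ho]).
      rewrite ev_cons, minus_IZR, mult_IZR.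
      destruct IH as [k Hk], Hx as [l Hl]; exists (k + l)%Z.
      rewrite plus_IZR; lra.
  - rewrite !ev_cons; apply eqS1_eq with (2 := IH v _ H); ring.
Qed.

Lemma euclid_holds (fuel : nat) (p x : Z) (r v : list Z) (rho : list R) :
  holds rho (p :: r) -> holds rho (x :: v) ->
  let '(g, r', v') := euclid fuel p r x v in
  holds rho (g :: r') /\ holds (tl rho) v'.
Proof.
  revert p r x v; induction fuel as [|fuel IH]; intros p r x v Hp Hx; simpl.
  - split; [easy|apply eqS1_refl].
  - destruct (Z.eqb_spec x 0) as [E|_].
    + split; [easy|]; unfold holds in *; rewrite ev_cons, E in Hx.
      revert Hx; apply eqS1_eq; ring.
    + apply IH; [easy|].
      change (holds rho (sub_mul (p :: r) (p / x) (x :: v))).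
      unfold holds; rewrite ev_sub_mul; now apply eqS1_sub_mul.
Qed.

Lemma insert_holds (L : lattice) (v : list Z) (rho : list R) :
  lattice_holds L rho -> holds rho v -> lattice_holds (insert L v) rho.
Proof.
  revert v rho; induction L as [|o L IH]; intros v rho HL Hv; [easy|].
  destruct o as [[p r]|], v as [|x v]; cbn [insert]; try exact HL.
  - destruct HL as [Hp HL].
    pose proof (euclid_holds 50 p x r v rho Hp Hv) as H.
    destruct (euclid 50 p r x v) as [[g r'] v'], H as [Hg Hv'].
    split; [easy|now apply IH].
  - destruct (Z.eqb_spec x 0) as [E|_]; simpl.
    + split; [easy|]; apply IH; [apply HL|].
      unfold holds in *; rewrite ev_cons, E in Hv.
      revert Hv; apply eqS1_eq; ring.
    + split; [easy|apply HL].
Qed.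

Lemma eqvP (v w : list Z) : eqv v w = true -> v = w.
Proof.
  revert w; induction v as [|x v IH]; intros [|y w]; simpl; try easy.
  intros H; apply andb_true_iff in H as [H1 H2].
  apply Z.eqb_eq in H1; rewrite H1; f_equal; auto.
Qed.

Lemma odd_count_toggle (rho : list R) (v : list Z) (l : list (list Z)) (x : R) :
  odd_count (map (fun t => ev t rho) (toggle v l)) x
  = xorb (at_pt (ev v rho) x) (odd_count (map (fun t => ev t rho) l) x).
Proof.
  induction l as [|w l IH]; simpl; [easy|].
  destruct (eqv v w) eqn:E.
  - apply eqvP in E; subst w.
    now rewrite <- xorb_assoc, xorb_nilpotent, xorb_false_l.
  - simpl; rewrite IH; destruct (at_pt (ev v rho) x), (at_pt (ev w rho) x); easy.
Qed.

Lemma cancel_cancels (rho : list R) (L : lattice) (ts : list (list Z)) :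
  lattice_holds L rho -> cancels rho ts -> cancels rho (cancel L ts).
Proof.
  intros HL H x; rewrite <- (H x); clear H.
  induction ts as [|t ts IH]; [easy|].
  change (cancel L (t :: ts)) with (toggle (reduce L t) (cancel L ts)).
  rewrite odd_count_toggle, IH; simpl; f_equal.
  now apply at_pt_l, reduce_eqS1.
Qed.

Lemma in_lattice_holds (rho : list R) (L : lattice) (v : list Z) :
  lattice_holds L rho -> in_lattice L v = true -> holds rho v.
Proof.
  intros HL H; apply eqS1_trans with (ev (reduce L v) rho).
  - now apply eqS1_sym, reduce_eqS1.
  - unfold in_lattice in H; revert H; generalize (reduce L v); clear.
    intros v; revert rho; induction v as [|x v IH]; intros rho H;
      [apply eqS1_refl|].
    cbn [forallb] in H; apply andb_true_iff in H as [E H].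
    apply Z.eqb_eq in E; rewrite ev_cons, <- E.
    specialize (IH (tl rho) H); revert IH; apply eqS1_eq; ring.
Qed.

Lemma select_cancels (rho : list R) (L : lattice) (rules : list rule)
    (best : list (list Z)) :
  lattice_holds L rho -> Forall (valid rho) rules -> cancels rho best ->
  cancels rho (select L best rules).
Proof.
  intros HL; revert best; induction rules as [|[ps ts] rules IH];
    intros best HR Hb; [easy|].
  apply Forall_cons_iff in HR as [Hr HR]; simpl.
  destruct (forallb (in_lattice L) ps) eqn:E; [|auto].
  assert (Hq : cancels rho (cancel L ts)).
  { apply cancel_cancels; [easy|]; apply Hr; simpl; apply Forall_forall.
    intros p Hp; apply in_lattice_holds with L; [easy|].
    rewrite forallb_forall in E; auto. }
  destruct (cancel L ts) as [|t1 [|t2 [|t3 q]]]; auto.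
  destruct best; auto.
  destruct (Nat.ltb _ _); auto.
Qed.

(** At the point of the first term the remaining terms must have odd count, so one of them lies
    there. *)
Lemma cancels_cons (rho : list R) (t : list Z) (ts : list (list Z)) :
  cancels rho (t :: ts) -> exists t', In t' ts /\ holds rho (sub_mul t 1 t').
Proof.
  intros H; specialize (H (ev t rho)); simpl in H.
  rewrite (proj2 (at_ptP _ _) (eqS1_refl _)) in H.
  assert (K : odd_count (map (fun t => ev t rho) ts) (ev t rho) = true ->
    exists t', In t' ts /\ holds rho (sub_mul t 1 t')).
  { clear H; induction ts as [|t' ts IH]; simpl; [easy|].
    destruct (at_pt (ev t' rho) (ev t rho)) eqn:E; intros H.
    - exists t'; split; [now left|].
      apply at_ptP in E; unfold holds; rewrite ev_sub_mul.
      revert E; apply eqS1_eq; ring.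
    - rewrite xorb_false_l in H; destruct (IH H) as [t'' [h h']].
      exists t''; split; [now right|easy]. }
  apply K; revert H; now destruct (odd_count _ _).
Qed.

(** Some branch adds a relation that is true in [rho], and the recursive call refutes that branch; a
    single leftover term has no branch at all. *)
Theorem refute_sound (fuel : nat) (rules : list rule) (L : lattice)
    (rho : list R) :
  lattice_holds L rho -> Forall (valid rho) rules ->
  refute fuel rules L = true -> False.
Proof.
  revert L; induction fuel as [|fuel IH]; intros L HL HR H; [easy|].
  simpl in H.
  assert (Hs : cancels rho (select L [] rules)) by now apply select_cancels.
  destruct (select L [] rules) as [|t ts]; [easy|].
  destruct (cancels_cons rho t ts Hs) as [t' [Ht' E]].
  rewrite forallb_forall in H.
  apply (IH (insert L (sub_mul t 1 t'))); auto using insert_holds.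
Qed.

Definition sub (v w : list Z) : list Z := sub_mul v 1 w.
Definition add (v w : list Z) : list Z := sub_mul v (-1) w.
Definition scal (k : Z) (v : list Z) : list Z := sub_mul [] (- k) v.

Lemma ev_sub (v w : list Z) (rho : list R) :
  ev (sub v w) rho = ev v rho - ev w rho.
Proof. unfold sub; rewrite ev_sub_mul; ring. Qed.

Lemma ev_add (v w : list Z) (rho : list R) :
  ev (add v w) rho = ev v rho + ev w rho.
Proof. unfold add; rewrite ev_sub_mul; ring. Qed.

Lemma ev_scal (k : Z) (v : list Z) (rho : list R) :
  ev (scal k v) rho = IZR k * ev v rho.
Proof. unfold scal; rewrite ev_sub_mul, opp_IZR; simpl; ring. Qed.

Definition zeros (n : nat) : list Z := repeat 0%Z n.

Fixpoint basis (n i : nat) : list Z :=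
  match n, i with
  | O, _ => []
  | S n', O => 1%Z :: zeros n'
  | S n', S i' => 0%Z :: basis n' i'
  end.

Lemma ev_zeros (n : nat) (rho : list R) : ev (zeros n) rho = 0.
Proof.
  revert rho; induction n as [|n IH]; intros [|r rho]; simpl; try easy.
  change (repeat 0%Z n) with (zeros n); rewrite IH; ring.
Qed.

Lemma ev_basis (n i : nat) (rho : list R) :
  (i < n)%nat -> ev (basis n i) rho = nth i rho 0.
Proof.
  revert i rho; induction n as [|n IH]; intros [|i] [|r rho] H; simpl;
    try easy; try lia.
  - rewrite ev_zeros; ring.
  - rewrite IH by lia; ring.
Qed.

Lemma cancels_pair (rho : list R) (v w : list Z) :
  eqS1 (ev v rho) (ev w rho) -> cancels rho [v; w].
Proof.
  intros H x; simpl; rewrite (at_pt_l _ _ x H).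
  now destruct (at_pt (ev w rho) x).
Qed.

Lemma odd_count_reflect (s : R) (l : list R) (x : R) :
  odd_count (map (fun w => s - w) l) x = odd_count l (s - x).
Proof.
  induction l as [|w l IH]; simpl; [easy|].
  rewrite IH; f_equal; symmetry; apply at_pt_refl.
  apply eqS1_eq with 0 0; [ring|apply eqS1_refl].
Qed.

(** * Points in general position *)

(** The difference has order neither 1, 4 nor 5 in the circle group; this is how [T'] is used. *)
Definition generic_pair (a b : R) : Prop :=
  ~ eqS1 a b /\ ~ eqS1 (5 * (a - b)) 0 /\
  (eqS1 (4 * (a - b)) 0 -> eqS1 (2 * (a - b)) 0).

Definition generic (n : nat) (p : nat -> R) : Prop :=
  forall i j : nat, (i < n)%nat -> (j < n)%nat -> i <> j ->
    generic_pair (p i) (p j).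

(** The circle has only one element of order 2, so [a - b] and [a - c] would both equal 1/2. *)
Lemma half_differences (a b c : R) :
  ~ eqS1 a b -> ~ eqS1 a c -> ~ eqS1 b c ->
  eqS1 (2 * (a - b)) 0 -> eqS1 (2 * (a - c)) 0 -> False.
Proof.
  intros Hab Hac Hbc [k Hk] [l Hl].
  destruct (Z.Even_or_Odd k) as [[k' ->]|[k' ->]].
  { apply Hab; exists k'; rewrite mult_IZR in Hk; lra. }
  destruct (Z.Even_or_Odd l) as [[l' ->]|[l' ->]].
  { apply Hac; exists l'; rewrite mult_IZR in Hl; lra. }
  apply Hbc; exists (l' - k')%Z; rewrite minus_IZR.
  rewrite plus_IZR, mult_IZR in Hk, Hl; lra.
Qed.

(** A lone [zero] cannot cancel, so the conclusion [[zero]] encodes falsity; [[scal 2 d; zero]]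
    encodes [2d = 0]. *)
Definition pair_rules (zero v w : list Z) : list rule :=
  let d := sub v w in
  [([d], [zero]); ([scal 5 d], [zero]); ([scal 4 d], [scal 2 d; zero])].

Definition triple_rule (zero u v w : list Z) : rule :=
  ([scal 2 (sub u v); scal 2 (sub u w)], [zero]).

Lemma pair_rules_valid (rho : list R) (n : nat) (v w : list Z) :
  generic_pair (ev v rho) (ev w rho) ->
  Forall (valid rho) (pair_rules (zeros n) v w).
Proof.
  intros (H1 & H5 & H4); unfold pair_rules.
  repeat apply Forall_cons; try apply Forall_nil; intros H; simpl in H;
    apply Forall_inv in H; unfold holds in H;
    rewrite ?ev_scal, ev_sub in H; simpl snd.
  - exfalso; apply H1; revert H; apply eqS1_eq; ring.
  - now exfalso; apply H5.
  - apply cancels_pair; rewrite ev_zeros, ev_scal, ev_sub; auto.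
Qed.

Lemma triple_rule_valid (rho : list R) (n : nat) (u v w : list Z) :
  generic_pair (ev u rho) (ev v rho) -> generic_pair (ev u rho) (ev w rho) ->
  generic_pair (ev v rho) (ev w rho) ->
  valid rho (triple_rule (zeros n) u v w).
Proof.
  intros (H1 & _) (H2 & _) (H3 & _) H; exfalso; simpl in H.
  apply Forall_cons_iff in H as [Ha H]; apply Forall_inv in H as Hb.
  unfold holds in Ha, Hb; rewrite ev_scal, ev_sub in Ha, Hb.
  now apply (half_differences (ev u rho) (ev v rho) (ev w rho)).
Qed.

(** * A cube of colorings without translational symmetry *)

(** Subsets of the three points are coded by the bits of a number below 8. *)
Definition masks : list nat := seq 0 8.
Definition bits (A : nat) : list nat := filter (Nat.testbit A) [0; 1; 2]%nat.
Definition flip_bit (A i : nat) : nat := Nat.lxor A (Nat.shiftl 1 i).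

(** The 11 unknowns are the eight reflections [s_A], followed by the three points. *)
Definition refl_vec (A : nat) : list Z := basis 11 A.
Definition pt_vec (i : nat) : list Z := basis 11 (8 + i).

(** The premises make [D] invariant under the reflection [s_A]. The coloring flipped on [D] then
    keeps this reflection, and it has only one. *)
Definition unique_rule (ps : list (list Z)) (A : nat) (D : list nat) : rule :=
  (map (fun v => sub v (refl_vec A)) ps,
   [refl_vec A; refl_vec (fold_left flip_bit D A)]).

Definition unique_rules (A : nat) : list rule :=
  map (fun i => unique_rule [scal 2 (pt_vec i)] A [i]) [0; 1; 2]%nat
  ++ map (fun '(i, j) => unique_rule [add (pt_vec i) (pt_vec j)] A [i; j])
       [(0, 1); (0, 2); (1, 2)]%nat
  ++ map (fun '(i, j, k) =>
         unique_rule [scal 2 (pt_vec k); add (pt_vec i) (pt_vec j)] A [k; i; j])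
       [(0, 1, 2); (0, 2, 1); (1, 2, 0)]%nat.

(** Conversely, if flipping [D] keeps the reflection, then [D] and its mirror image cancel mod 2. *)
Definition equal_rule (A : nat) (D : list nat) : rule :=
  ([sub (refl_vec A) (refl_vec (fold_left flip_bit D A))],
   map pt_vec D ++ map (fun i => sub (refl_vec A) (pt_vec i)) D).

Definition equal_rules (A : nat) : list rule :=
  map (equal_rule A) [[0]; [1]; [2]; [0; 1]; [0; 2]; [1; 2]; [0; 1; 2]]%nat.

(* With [s0], [s1], [s2] the reflections of [g], [g + u], [g + v], the coloring
   [g] changes under the translation by [t1 = s1 - s0] exactly at [s0 - u] and
   [u - t1], and similarly for [t2]; the two translations commute. *)
Definition square_rule (A i j : nat) : rule :=
  let u := pt_vec i in
  let v := pt_vec j in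
  let s0 := refl_vec A in
  let t1 := sub (refl_vec (flip_bit A i)) s0 in
  let t2 := sub (refl_vec (flip_bit A j)) s0 in
  ([], [sub s0 u; sub u t1; sub (sub s0 u) t2; sub (sub u t1) t2;
        sub s0 v; sub v t2; sub (sub s0 v) t1; sub (sub v t2) t1]).

Definition square_rules (A : nat) : list rule :=
  map (fun '(i, j) => square_rule A i j) [(0, 1); (0, 2); (1, 2)]%nat.

Definition cube_rules : list rule :=
  flat_map (fun '(i, j) => pair_rules (zeros 11) (pt_vec i) (pt_vec j))
    [(0, 1); (0, 2); (1, 2)]%nat
  ++ [triple_rule (zeros 11) (pt_vec 0) (pt_vec 1) (pt_vec 2)]
  ++ flat_map unique_rules masks
  ++ flat_map equal_rules masks
  ++ flat_map square_rules masks.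

Lemma cube_refuted : refute 60 cube_rules (repeat None 11) = true.
Proof. vm_compute; reflexivity. Qed.

(** * Validity of the cube rules *)

Lemma masks_spec (A : nat) : In A masks <-> (A < 8)%nat.
Proof. unfold masks; rewrite in_seq; lia. Qed.

Lemma flip_bit_lt (A i : nat) : (A < 8)%nat -> (i < 3)%nat -> (flip_bit A i < 8)%nat.
Proof.
  intros HA Hi.
  do 3 (destruct i as [|i]; [do 8 (destruct A as [|A]; [vm_compute; lia|]); lia|]).
  lia.
Qed.

Lemma fold_flip_bit_lt (A : nat) (D : list nat) :
  (A < 8)%nat -> Forall (fun i => i < 3)%nat D ->
  (fold_left flip_bit D A < 8)%nat.
Proof.
  revert A; induction D as [|i D IH]; intros A HA HD; simpl; [easy|].
  apply Forall_cons_iff in HD as [Hi HD]; auto using flip_bit_lt.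
Qed.

Definition cube (g : nat -> R -> bool) (s p : nat -> R) : Prop :=
  forall A : nat, (A < 8)%nat ->
    periodic (g A) /\ reflected (g A) (s A) /\ ~ translated (g A) /\
    forall i : nat, (i < 3)%nat ->
      forall x : R, g (flip_bit A i) x = xorb (g A x) (at_pt (p i) x).

Definition cube_env (s p : nat -> R) : list R :=
  map s (seq 0 8) ++ map p (seq 0 3).

Lemma ev_refl_vec (s p : nat -> R) (A : nat) :
  (A < 8)%nat -> ev (refl_vec A) (cube_env s p) = s A.
Proof.
  intros HA; unfold refl_vec; rewrite ev_basis by lia.
  do 8 (destruct A as [|A]; [reflexivity|]); lia.
Qed.

Lemma ev_pt_vec (s p : nat -> R) (i : nat) :
  (i < 3)%nat -> ev (pt_vec i) (cube_env s p) = p i.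
Proof.
  intros Hi; unfold pt_vec; rewrite ev_basis by lia.
  do 3 (destruct i as [|i]; [reflexivity|]); lia.
Qed.

Lemma map_ev_pt_vec (s p : nat -> R) (D : list nat) :
  Forall (fun i => i < 3)%nat D ->
  map (fun t => ev t (cube_env s p)) (map pt_vec D) = map p D.
Proof.
  rewrite Forall_forall; intros HD; rewrite map_map; apply map_ext_in.
  intros i Hi; apply ev_pt_vec; auto.
Qed.

Lemma cube_fold (g : nat -> R -> bool) (s p : nat -> R) (A : nat)
    (D : list nat) (x : R) :
  cube g s p -> (A < 8)%nat -> Forall (fun i => i < 3)%nat D ->
  g (fold_left flip_bit D A) x = xorb (g A x) (odd_count (map p D) x).
Proof.
  intros H; revert A; induction D as [|i D IH]; intros A HA HD; simpl.
  - now rewrite xorb_false_r.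
  - apply Forall_cons_iff in HD as [Hi HD].
    rewrite IH by auto using flip_bit_lt.
    destruct (H A HA) as (_ & _ & _ & E); rewrite (E i Hi); apply xorb_assoc.
Qed.

Lemma unique_rule_valid (g : nat -> R -> bool) (s p : nat -> R)
    (ps : list (list Z)) (A : nat) (D : list nat) :
  cube g s p -> (A < 8)%nat -> Forall (fun i => i < 3)%nat D ->
  (Forall (fun v => eqS1 (ev v (cube_env s p)) (s A)) ps ->
   forall x, odd_count (map p D) (s A - x) = odd_count (map p D) x) ->
  valid (cube_env s p) (unique_rule ps A D).
Proof.
  intros H HA HD K Hps; simpl in *.
  pose proof (fold_flip_bit_lt A D HA HD) as HB.
  apply cancels_pair; rewrite !ev_refl_vec by easy.
  destruct (H A HA) as (_ & RA & _), (H _ HB) as (_ & RB & NB & _).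
  apply (reflected_unique _ _ _ NB); [|easy].
  intros x; rewrite !(cube_fold g s p A D) by easy; rewrite RA, K; [easy|].
  rewrite Forall_map in Hps; revert Hps; apply Forall_impl; intros v Hv.
  unfold holds in Hv; rewrite ev_sub, ev_refl_vec in Hv by easy.
  revert Hv; apply eqS1_eq; ring.
Qed.

Lemma unique_rules_valid (g : nat -> R -> bool) (s p : nat -> R) (A : nat) :
  cube g s p -> (A < 8)%nat ->
  Forall (valid (cube_env s p)) (unique_rules A).
Proof.
  intros H HA.
  unfold unique_rules; rewrite !Forall_app, !Forall_map, !Forall_forall.
  split; [|split].
  - intros i Hi; assert (i < 3)%nat by (simpl in Hi; lia).
    apply unique_rule_valid with g; auto; intros K x.
    apply Forall_inv in K; rewrite ev_scal, ev_pt_vec in K by easy.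
    simpl; f_equal; apply at_pt_refl; revert K; apply eqS1_eq; ring.
  - intros [i j] Hij.
    assert (i < 3 /\ j < 3)%nat as [Hi Hj].
    { simpl in Hij; repeat destruct Hij as [Hij|Hij]; inversion Hij; lia. }
    apply unique_rule_valid with g; auto; intros K x.
    apply Forall_inv in K; rewrite ev_add, !ev_pt_vec in K by easy.
    simpl; rewrite (at_pt_refl (s A) (p i) (p j) x K).
    rewrite (at_pt_refl (s A) (p j) (p i) x) by (now rewrite Rplus_comm).
    now destruct (at_pt (p i) x), (at_pt (p j) x).
  - intros [[i j] k] Hij.
    assert (i < 3 /\ j < 3 /\ k < 3)%nat as (Hi & Hj & Hk).
    { simpl in Hij; repeat destruct Hij as [Hij|Hij]; inversion Hij; lia. }
    apply unique_rule_valid with g; auto; intros K x.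
    apply Forall_cons_iff in K as [K1 K]; apply Forall_inv in K.
    rewrite ev_add, !ev_pt_vec in K by easy.
    rewrite ev_scal, ev_pt_vec in K1 by easy.
    simpl; rewrite (at_pt_refl (s A) (p i) (p j) x K).
    rewrite (at_pt_refl (s A) (p j) (p i) x) by (now rewrite Rplus_comm).
    rewrite (at_pt_refl (s A) (p k) (p k) x)
      by (revert K1; apply eqS1_eq; ring).
    now destruct (at_pt (p i) x), (at_pt (p j) x), (at_pt (p k) x).
Qed.

Lemma equal_rule_valid (g : nat -> R -> bool) (s p : nat -> R) (A : nat)
    (D : list nat) :
  cube g s p -> (A < 8)%nat -> Forall (fun i => i < 3)%nat D ->
  valid (cube_env s p) (equal_rule A D).
Proof.
  intros H HA HD K x; simpl in *.
  pose proof (fold_flip_bit_lt A D HA HD) as HB.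
  apply Forall_inv in K; unfold holds in K.
  rewrite ev_sub, !ev_refl_vec in K by easy.
  rewrite map_app, map_ev_pt_vec by easy.
  replace (map _ (map (fun i => sub _ _) D))
    with (map (fun w => s A - w) (map p D)).
  2:{ rewrite !map_map; apply map_ext_in; intros i Hi.
      rewrite Forall_forall in HD.
      rewrite ev_sub, ev_refl_vec, ev_pt_vec; auto. }
  rewrite odd_count_app, odd_count_reflect.
  destruct (H A HA) as (_ & RA & _), (H _ HB) as (PB & RB & _).
  assert (RB' : reflected (g (fold_left flip_bit D A)) (s A)).
  { apply reflected_eqS1 with (s (fold_left flip_bit D A)); auto.
    apply eqS1_sym; revert K; apply eqS1_eq; ring. }
  specialize (RB' x); rewrite !(cube_fold g s p A D), RA in RB' by easy.
  revert RB'; now destruct (g A x), (odd_count _ (s A - x)), (odd_count _ x).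
Qed.

Lemma square_cancels (g : R -> bool) (s0 s1 s2 u v x : R) :
  reflected g s0 -> reflected (flip g [u]) s1 -> reflected (flip g [v]) s2 ->
  odd_count [s0 - u; u - (s1 - s0); s0 - u - (s2 - s0); u - (s1 - s0) - (s2 - s0);
             s0 - v; v - (s2 - s0); s0 - v - (s1 - s0); v - (s2 - s0) - (s1 - s0)]
    x = false.
Proof.
  intros H0 H1 H2.
  (* The reflections [s0] and [s] compose to the translation by [s - s0], which changes [g] by the
     indicators of [s0 - w] and [w - (s - s0)]. *)
  assert (T : forall s w, reflected (flip g [w]) s -> forall y,
    g (y + (s - s0)) = xorb (g y) (xorb (at_pt (s0 - w) y) (at_pt (w - (s - s0)) y))).
  { intros s w H y; specialize (H (s0 - y)); unfold flip in H; simpl in H.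
    rewrite H0, !xorb_false_r in H.
    replace (s - (s0 - y)) with (y + (s - s0)) in H by ring.
    rewrite (at_pt_refl s0 w (s0 - w) y) in H
      by (apply eqS1_eq with 0 0; [ring|apply eqS1_refl]).
    rewrite (at_pt_shift w (y + (s - s0)) (w - (s - s0)) y) in H by ring.
    revert H; destruct (g (y + (s - s0))), (g y), (at_pt (s0 - w) y),
      (at_pt (w - (s - s0)) y); easy. }
  pose proof (T _ _ H1 x) as A1; pose proof (T _ _ H2 x) as A2.
  (* The two translations are applied in both orders; equating the expansions, the values of [g]
     cancel. *)
  pose proof (T _ _ H1 (x + (s2 - s0))) as B1.
  pose proof (T _ _ H2 (x + (s1 - s0))) as B2.
  replace (x + (s1 - s0) + (s2 - s0)) with (x + (s2 - s0) + (s1 - s0)) in B2 by ring.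
  rewrite B1, A1, A2 in B2; clear - B2.
  rewrite (at_pt_shift (s0 - u) (x + (s2 - s0)) (s0 - u - (s2 - s0)) x) in B2 by ring.
  rewrite (at_pt_shift (s0 - v) (x + (s1 - s0)) (s0 - v - (s1 - s0)) x) in B2 by ring.
  rewrite (at_pt_shift (u - (s1 - s0)) (x + (s2 - s0))
    (u - (s1 - s0) - (s2 - s0)) x) in B2 by ring.
  rewrite (at_pt_shift (v - (s2 - s0)) (x + (s1 - s0))
    (v - (s2 - s0) - (s1 - s0)) x) in B2 by ring.
  unfold odd_count; simpl; revert B2.
  do 8 match goal with |- context [at_pt ?a x] => generalize (at_pt a x) end.
  generalize (g x); intros b b1 b2 b3 b4 b5 b6 b7 b8.
  destruct b, b1, b2, b3, b4, b5, b6, b7, b8; easy.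
Qed.

Lemma square_rule_valid (g : nat -> R -> bool) (s p : nat -> R) (A i j : nat) :
  cube g s p -> (A < 8)%nat -> (i < 3)%nat -> (j < 3)%nat ->
  valid (cube_env s p) (square_rule A i j).
Proof.
  intros H HA Hi Hj _ x; unfold square_rule; cbn [snd map].
  rewrite !ev_sub, !ev_refl_vec, !ev_pt_vec by auto using flip_bit_lt.
  destruct (H A HA) as (_ & RA & _ & E).
  assert (F : forall k, (k < 3)%nat -> reflected (flip (g A) [p k]) (s (flip_bit A k))).
  { intros k Hk.
    destruct (H _ (flip_bit_lt A k HA Hk)) as (_ & Rk & _).
    apply reflected_ext with (2 := Rk); intros y.
    rewrite (E k Hk); unfold flip; simpl; now rewrite xorb_false_r. }
  apply square_cancels with (g A); auto.
Qed.

Lemma cube_impossible (g : nat -> R -> bool) (s p : nat -> R) :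
  generic 3 p -> cube g s p -> False.
Proof.
  intros Hp H.
  assert (HP : forall i j, (i < 3)%nat -> (j < 3)%nat -> i <> j ->
    generic_pair (ev (pt_vec i) (cube_env s p)) (ev (pt_vec j) (cube_env s p))).
  { intros i j Hi Hj Hij; rewrite !ev_pt_vec by easy; auto. }
  apply refute_sound with (3 := cube_refuted) (rho := cube_env s p).
  { repeat split. }
  unfold cube_rules; rewrite !Forall_app, !Forall_flat_map, !Forall_forall.
  repeat split.
  - intros [i j] Hij; apply pair_rules_valid.
    simpl in Hij; repeat destruct Hij as [Hij|Hij]; inversion Hij; subst;
      apply HP; lia.
  - intros r [<-|[]]; apply triple_rule_valid; apply HP; lia.
  - intros A HA; apply masks_spec in HA; now apply unique_rules_valid with g.
  - intros A HA; apply masks_spec in HA.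
    unfold equal_rules, square_rules; rewrite Forall_map, Forall_forall; intros D HD.
    apply equal_rule_valid with g; auto.
    simpl in HD; repeat destruct HD as [HD|HD]; try easy; subst;
      repeat (apply Forall_cons; [lia|]); apply Forall_nil.
  - intros A HA; apply masks_spec in HA.
    unfold equal_rules, square_rules; rewrite Forall_map, Forall_forall; intros [i j] Hij.
    simpl in Hij; repeat destruct Hij as [Hij|Hij]; inversion Hij; subst;
      apply square_rule_valid with g; auto; lia.
Qed.

Lemma exists_translated (c : R -> bool) (p : nat -> R) :
  periodic c -> generic 3 p ->
  (forall A, (A < 8)%nat -> symmetric (flip c (map p (bits A)))) ->
  exists A, (A < 8)%nat /\ translated (flip c (map p (bits A))).
Proof.
  intros Hc Hp HS; apply NNPP; intros N.
  set (g := fun A => flip c (map p (bits A))) in *.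
  (* Each coloring is symmetric without a period, so [epsilon] picks a genuine reflection of it. *)
  apply (cube_impossible g (fun A => epsilon (inhabits 0) (reflected (g A))) p Hp).
  intros A HA.
  assert (NT : ~ translated (g A)) by (intros T; apply N; now exists A).
  split; [now apply periodic_flip|split; [|split; [easy|]]].
  - apply epsilon_spec; now destruct (HS A HA).
  - intros i Hi x; unfold g, flip.
    do 3 (destruct i as [|i];
      [do 8 (destruct A as [|A];
        [cbn; destruct (c x), (at_pt (p 0%nat) x), (at_pt (p 1%nat) x),
          (at_pt (p 2%nat) x); reflexivity|]); lia|]); lia.
Qed.

(** * Colorings with translational symmetry *)

(** [skip k] enumerates the indices below 4 other than [k], so [face k] runs through the subsets
    containing [k], which are never empty. *)
Definition skip (k i : nat) : nat := if (i <? k)%nat then i else S i.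
Definition face (k A : nat) : list nat := k :: map (skip k) (bits A).

(** If [D] is invariant under the reflection fixing point [j], then [D] and its mirror image cancel
    mod 2. *)
Definition invariant_rule (D : list nat) (j : nat) : rule :=
  ([], map (basis 4) D ++
       map (fun i => sub (scal 2 (basis 4 j)) (basis 4 i)) D).

Definition four_rules : list rule :=
  flat_map (fun '(i, j) => pair_rules (zeros 4) (basis 4 i) (basis 4 j))
    [(0, 1); (0, 2); (0, 3); (1, 2); (1, 3); (2, 3)]%nat
  ++ map (fun '(i, j, k) =>
         triple_rule (zeros 4) (basis 4 i) (basis 4 j) (basis 4 k))
       [(0, 1, 2); (0, 1, 3); (0, 2, 3); (1, 2, 3)]%nat.

Definition invariant_rules (D : list nat) : list rule :=
  map (invariant_rule D) [0; 1; 2; 3]%nat.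

Definition refute_four (rules : list rule) : bool :=
  refute 40 (four_rules ++ rules) (repeat None 4).

(* Only an equilateral triple is invariant under all four reflections, and two
   distinct triples of [W] cannot both be equilateral. *)
Lemma invariant_refuted :
  forallb (fun A =>
    refute_four (invariant_rules (face 0 A)) ||
    existsb (fun k => forallb (fun B =>
        refute_four (invariant_rules (face 0 A) ++ invariant_rules (face k B)))
      masks) [1; 2; 3]%nat) masks = true.
Proof. vm_compute; reflexivity. Qed.

Definition invariant (p : nat -> R) (D : list nat) : Prop :=
  forall (j : nat) (x : R), (j < 4)%nat ->
    odd_count (map p D) (2 * p j - x) = odd_count (map p D) x.

Lemma bits_lt (A : nat) : Forall (fun i => i < 3)%nat (bits A).
Proof.
  apply Forall_forall; intros i Hi; apply filter_In in Hi as [Hi _].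
  simpl in Hi; lia.
Qed.

Lemma skip_lt (k i : nat) : (i < 3)%nat -> (skip k i < 4)%nat.
Proof. unfold skip; destruct (Nat.ltb_spec i k); lia. Qed.

Lemma face_lt (k A : nat) : (k < 4)%nat -> Forall (fun i => i < 4)%nat (face k A).
Proof.
  intros Hk; constructor; [easy|].
  rewrite Forall_map; apply Forall_impl with (2 := bits_lt A); apply skip_lt.
Qed.

Lemma ev_basis4 (p : nat -> R) (i : nat) :
  (i < 4)%nat -> ev (basis 4 i) (map p (seq 0 4)) = p i.
Proof.
  intros Hi; rewrite ev_basis by easy.
  do 4 (destruct i as [|i]; [reflexivity|]); lia.
Qed.

Lemma invariant_rules_valid (p : nat -> R) (D : list nat) :
  Forall (fun i => i < 4)%nat D -> invariant p D ->
  Forall (valid (map p (seq 0 4))) (invariant_rules D).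
Proof.
  intros HD H; unfold invariant_rules; rewrite Forall_map, Forall_forall.
  intros j Hj _ x; assert (j < 4)%nat by (simpl in Hj; lia).
  rewrite Forall_forall in HD.
  cbn [snd invariant_rule]; rewrite map_app, odd_count_app, !map_map.
  replace (map (fun i => ev (sub _ _) _) D)
    with (map (fun w => 2 * p j - w) (map p D)).
  2:{ rewrite map_map; apply map_ext_in; intros i Hi.
      rewrite ev_sub, ev_scal, !ev_basis4; auto. }
  replace (map (fun i => ev _ _) D) with (map p D).
  2:{ apply map_ext_in; intros i Hi; rewrite ev_basis4; auto. }
  rewrite odd_count_reflect, H by easy; apply xorb_nilpotent.
Qed.

Lemma refute_four_sound (p : nat -> R) (rules : list rule) :
  generic 4 p -> Forall (valid (map p (seq 0 4))) rules ->
  refute_four rules = true -> False.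
Proof.
  intros Hp HR.
  assert (HP : forall i j, (i < 4)%nat -> (j < 4)%nat -> i <> j ->
    generic_pair (ev (basis 4 i) (map p (seq 0 4)))
      (ev (basis 4 j) (map p (seq 0 4)))).
  { intros i j Hi Hj Hij; rewrite !ev_basis4 by easy; auto. }
  apply (refute_sound 40 _ _ (map p (seq 0 4))); [repeat split|].
  apply Forall_app; split; [|easy].
  unfold four_rules; rewrite Forall_app, Forall_flat_map, Forall_map, !Forall_forall.
  split.
  - intros [i j] Hij; apply pair_rules_valid.
    simpl in Hij; repeat destruct Hij as [Hij|Hij]; inversion Hij; subst;
      apply HP; lia.
  - intros [[i j] k] Hij.
    simpl in Hij; repeat destruct Hij as [Hij|Hij]; inversion Hij; subst;
      apply triple_rule_valid; apply HP; lia.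
Qed.

Lemma invariant_impossible (p : nat -> R) :
  generic 4 p ->
  (forall k, (k < 4)%nat -> exists A, (A < 8)%nat /\ invariant p (face k A)) ->
  False.
Proof.
  intros Hp H.
  assert (V : forall k A, (k < 4)%nat -> invariant p (face k A) ->
    Forall (valid (map p (seq 0 4))) (invariant_rules (face k A))).
  { intros k A Hk; apply invariant_rules_valid; now apply face_lt. }
  destruct (H 0%nat) as [A [HA IA]]; [lia|].
  pose proof invariant_refuted as E; rewrite forallb_forall in E.
  specialize (E A (proj2 (masks_spec A) HA)); apply orb_true_iff in E as [E|E].
  - apply refute_four_sound with p (invariant_rules (face 0 A)); auto.
    apply V; [lia|easy].
  (* The set containing 0 may be an equilateral triple; the check then supplies an index [k] such
     that no invariant set containing [k] is compatible with it. *)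
  - apply existsb_exists in E as [k [Hk E]].
    assert (k < 4)%nat by (simpl in Hk; lia).
    destruct (H k) as [B [HB IB]]; [easy|].
    rewrite forallb_forall in E; specialize (E B (proj2 (masks_spec B) HB)).
    revert E; apply refute_four_sound with p; auto.
    apply Forall_app; split; apply V; auto; lia.
Qed.

Definition all_symmetric (c : R -> bool) (p : nat -> R) : Prop :=
  forall l : list nat, Forall (fun i => i < 4)%nat l -> symmetric (flip c (map p l)).

Lemma all_symmetric_flip (c : R -> bool) (p : nat -> R) (l : list nat) :
  Forall (fun i => i < 4)%nat l -> all_symmetric c p ->
  all_symmetric (flip c (map p l)) p.
Proof.
  intros Hl H m Hm; apply symmetric_ext with (flip c (map p (l ++ m))).
  - intros x; now rewrite flip_flip, map_app.
  - apply H, Forall_app; auto.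
Qed.

Lemma translated_reflected (c : R -> bool) (p : nat -> R) (j : nat) :
  periodic c -> all_symmetric c p -> translated c -> (j < 4)%nat ->
  reflected c (2 * p j).
Proof.
  intros Hc H T Hj; apply translated_flip1; auto.
  apply (H [j]); auto.
Qed.

(** The subsets containing [k] form the cube on the other three points, based at [flip c [p k]]. *)
Lemma translated_face (c : R -> bool) (p : nat -> R) (k : nat) :
  periodic c -> generic 4 p -> all_symmetric c p -> (k < 4)%nat ->
  exists A, (A < 8)%nat /\ translated (flip c (map p (face k A))).
Proof.
  intros Hc Hp H Hk.
  destruct (exists_translated (flip c [p k]) (fun i => p (skip k i)))
    as [A [HA T]].
  - now apply periodic_flip.
  - intros i j Hi Hj Hij; apply Hp; auto using skip_lt.
    unfold skip; destruct (Nat.ltb_spec i k), (Nat.ltb_spec j k); lia.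
  - intros A _.
    apply symmetric_ext with (flip c (map p (face k A))); [|now apply H, face_lt].
    intros x; rewrite flip_flip; unfold face; simpl; now rewrite map_map.
  - exists A; split; [easy|].
    revert T; apply translated_ext; intros x.
    rewrite flip_flip; unfold face; simpl; now rewrite map_map.
Qed.

(** Some flip [d] has a period. Taking [d] as new base, for each [k] a further flip on some [D]
    containing [k] has one too. Both colorings have all four reflections [2 * p j], hence so does
    [D]. *)
Lemma not_all_symmetric (c : R -> bool) (p : nat -> R) :
  periodic c -> generic 4 p -> ~ all_symmetric c p.
Proof.
  intros Hc Hp H.
  destruct (translated_face c p 0 Hc Hp H) as [A0 [_ T]]; [lia|].
  set (l := face 0 A0) in T.
  assert (Hl : Forall (fun i => i < 4)%nat l) by (apply face_lt; lia).
  set (d := flip c (map p l)) in T.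
  assert (Hd : periodic d) by now apply periodic_flip.
  assert (Sd : all_symmetric d p) by now apply all_symmetric_flip.
  apply (invariant_impossible p Hp); intros k Hk.
  destruct (translated_face d p k Hd Hp Sd Hk) as [A [HA TA]].
  exists A; split; [easy|]; intros j x Hj.
  pose proof (translated_reflected d p j Hd Sd T Hj x) as E.
  assert (HF : Forall (fun i => i < 4)%nat (face k A)) by now apply face_lt.
  pose proof (translated_reflected _ p j (periodic_flip _ _ Hd)
    (all_symmetric_flip d p _ HF Sd) TA Hj x) as F.
  unfold flip at 1 2 in F; rewrite E in F.
  revert F; now destruct (d x), (odd_count _ (2 * p j - x)), (odd_count _ x).
Qed.

(** * The condition on W and the extension of precolorings *)

Lemma not_distinguishing_symmetric (g : R -> bool) :
  ~ distinguishing g -> symmetric g.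
Proof.
  intros H; apply NNPP; intros N; apply H; split.
  - intros a Ha; apply NNPP; intros Na; apply N; left; now exists a.
  - intros a Ha; apply N; right; exists (2 * a); intros x.
    rewrite <- (Ha x); unfold tau; f_equal; ring.
Qed.

Lemma T'_generic_pair (W : list R) (a b : R) :
  T' W -> Forall (fun w => 0 <= w < 1) W -> In a W -> In b W -> a <> b ->
  generic_pair a b.
Proof.
  intros HT HW Ha Hb Hab; rewrite Forall_forall in HW.
  assert (N : ~ eqS1 a b).
  { intros [k Hk]; apply HW in Ha, Hb.
    assert (-1 < k < 1)%Z by (split; apply lt_IZR; lra).
    replace k with 0%Z in Hk by lia; lra. }
  (* If [n (a - b) = m], then modulo 1 [a] is [b] shifted by [r / n] with [r] the residue of [m];
     [T'] excludes [r] coprime to [n]. *)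
  assert (Q : forall (n : nat) (m : Z), (n = 4%nat \/ n = 5%nat) ->
    INR n * (a - b) = IZR m -> Nat.gcd (Z.to_nat (m mod Z.of_nat n)) n <> 1%nat).
  { intros n m Hn E G.
    assert (n0 : (0 < Z.of_nat n)%Z) by lia.
    pose proof (Z.mod_pos_bound m _ n0) as Hr.
    pose proof (Z.div_mod m (Z.of_nat n)) as Hdm.
    set (r := Z.to_nat (m mod Z.of_nat n)) in *.
    assert (r <> 0)%nat by (intros r0; rewrite r0 in G; destruct Hn as [->| ->]; easy).
    apply (HT n r Hn) with b a; auto; [lia|].
    exists (- (m / Z.of_nat n))%Z.
    assert (n1 : 0 < INR n) by (apply lt_0_INR; lia).
    apply Rmult_eq_reg_l with (INR n); [|lra].
    transitivity (INR r - IZR m); [rewrite <- E; field; lra|].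
    rewrite Hdm at 1 by lia; unfold r.
    rewrite opp_IZR, plus_IZR, mult_IZR, !INR_IZR_INZ, Z2Nat.id by lia; ring. }
  split; [exact N|split].
  - intros [m Hm].
    assert (G := Q 5%nat m (or_intror eq_refl)); simpl INR in G.
    assert (E : m = (5 * (m / 5))%Z).
    { pose proof (Z.div_mod m 5); pose proof (Z.mod_pos_bound m 5).
      enough (m mod 5 = 0)%Z by lia.
      assert (K : (m mod 5 = 0 \/ m mod 5 = 1 \/ m mod 5 = 2 \/ m mod 5 = 3 \/
        m mod 5 = 4)%Z) by lia.
      change (Z.of_nat 5) with 5%Z in G.
      destruct K as [K|[K|[K|[K|K]]]]; [easy|..]; exfalso; apply G;
        (lra || (rewrite K; reflexivity)). }
    apply N; exists (m / 5)%Z; rewrite E, mult_IZR in Hm; lra.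
  - intros [m Hm].
    assert (G := Q 4%nat m (or_introl eq_refl)); simpl INR in G.
    (* The residues 1 and 3 are coprime to 4, so only even [m] remain. *)
    assert (E : exists q, m = (2 * q)%Z).
    { pose proof (Z.div_mod m 4); pose proof (Z.mod_pos_bound m 4).
      assert (K : (m mod 4 = 0 \/ m mod 4 = 1 \/ m mod 4 = 2 \/ m mod 4 = 3)%Z)
        by lia.
      change (Z.of_nat 4) with 4%Z in G.
      destruct K as [K|[K|[K|K]]].
      - exists (2 * (m / 4))%Z; lia.
      - exfalso; apply G; [lra|rewrite K; reflexivity].
      - exists (2 * (m / 4) + 1)%Z; lia.
      - exfalso; apply G; [lra|rewrite K; reflexivity]. }
    destruct E as [q ->]; exists q; rewrite mult_IZR in Hm; lra.
Qed.

Theorem theorem2p3p1 (W : list R) :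
  card4_S1 W -> trivial_pointwise_stab W -> T' W -> P W.
Proof.
  intros (len & nodup & range) _ HT c0 Hc0.
  pose proof (coloring_periodic c0 Hc0) as Hc.
  set (p := fun i => nth i W 0).
  assert (Hp : generic 4 p).
  { intros i j Hi Hj Hij; apply T'_generic_pair with W; auto;
      try (apply nth_In; lia).
    intros E; apply Hij; apply (proj1 (NoDup_nth W 0) nodup); auto; lia. }
  (* Every flip inside [W] is an extension of the precoloring, so if none is distinguishing then all
     are symmetric. *)
  apply NNPP; intros N; apply (not_all_symmetric c0 p Hc Hp); intros l Hl.
  apply not_distinguishing_symmetric; intros D; apply N.
  exists (flip c0 (map p l)); split; [|split; [exact D|]].
  - intros x; apply periodic_flip; [easy|].
    exists 1%Z; ring.
  - intros x Hx; unfold flip.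
    enough (odd_count (map p l) x = false) as -> by now destruct (c0 x).
    clear D; induction l as [|i l IH]; [easy|].
    apply Forall_cons_iff in Hl as [Hi Hl]; simpl; rewrite IH by easy.
    enough (at_pt (p i) x = false) as -> by easy.
    apply not_true_iff_false; rewrite at_ptP; intros E; apply Hx.
    exists (p i); split; [apply nth_In; lia|easy].
Qed.
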